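(* Let $r=r(s)$ be a smooth positive function on an open interval. The surface of revolution in $\mathbb{E}^3$ defined by $$\mathbf{x}(s,t)=(r(s)\cos t,\ r(s)\sin t,\ s)$$ has incompressible canonical vector field if and only if the function $r$ satisfies the second order differential equation $$(1+r'^2)\,(r+s r'+2 r r'^2)+r\,(r-s r')\,r''=0.$$
   Context: The position vector field $\mathbf{x}$ of a submanifold of Euclidean space (relative to the origin) decomposes as $\mathbf{x}=\mathbf{x}^T+\mathbf{x}^N$ into tangential and normal components; $\mathbf{x}^T$ is called the canonical vector field. A vector field on a Riemannian manifold is incompressible if its divergence vanishes at all points. Primes denote derivatives with respect to $s$. *)

(* Defs.v *)
From Stdlib Require Import Reals.
From Coquelicot Require Import Coquelicot.
Open Scope R_scope.

Definition E3 : Type := (R * R * R)%type.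

Definition vadd (u v : E3) : E3 :=
  let '(u1, u2, u3) := u in let '(v1, v2, v3) := v in
  (u1 + v1, u2 + v2, u3 + v3).

Definition vscale (c : R) (u : E3) : E3 :=
  let '(u1, u2, u3) := u in (c * u1, c * u2, c * u3).

Definition dot (u v : E3) : R :=
  let '(u1, u2, u3) := u in let '(v1, v2, v3) := v in
  u1 * v1 + u2 * v2 + u3 * v3.

Inductive coord : Type := cs | ct.

Definition sumc (f : coord -> R) : R := f cs + f ct.

Definition partial (i : coord) (f : R * R -> R) (p : R * R) : R :=
  match i with
  | cs => Derive (fun s => f (s, snd p)) (fst p)
  | ct => Derive (fun t => f (fst p, t)) (snd p)
  end.

(* Riemannian geometry of a metric [g i j] in the coordinates (s, t).
   A tangent vector field is given by its components in the coordinate frame. *)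

Definition metric : Type := coord -> coord -> R * R -> R.
Definition vfield : Type := coord -> R * R -> R.

Definition gdet (g : metric) (p : R * R) : R :=
  g cs cs p * g ct ct p - g cs ct p * g ct cs p.

(* Inverse matrix g^{ij}; meaningful where [gdet g p <> 0]. *)
Definition ginv (g : metric) (i j : coord) (p : R * R) : R :=
  match i, j with
  | cs, cs => g ct ct p / gdet g p
  | cs, ct => - g cs ct p / gdet g p
  | ct, cs => - g ct cs p / gdet g p
  | ct, ct => g cs cs p / gdet g p
  end.

(* [christoffel g k i j] is Gamma^k_{ij} of the Levi-Civita connection. *)
Definition christoffel (g : metric) (k i j : coord) (p : R * R) : R :=
  / 2 * sumc (fun l => ginv g k l p *
    (partial i (g j l) p + partial j (g i l) p - partial l (g i j) p)).

(* The k-th component of nabla_{d_i} V. *)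
Definition nabla (g : metric) (i : coord) (V : vfield) (k : coord)
    (p : R * R) : R :=
  partial i (V k) p + sumc (fun j => christoffel g k i j p * V j p).

(* div V = trace (X |-> nabla_X V) *)
Definition divergence (g : metric) (V : vfield) (p : R * R) : R :=
  sumc (fun i => nabla g i V i p).

Definition incompressible (D : R * R -> Prop) (g : metric) (V : vfield) : Prop :=
  forall p, D p -> divergence g V p = 0.

Definition tangent (X : R * R -> E3) (i : coord) (p : R * R) : E3 :=
  (partial i (fun q => fst (fst (X q))) p,
   partial i (fun q => snd (fst (X q))) p,
   partial i (fun q => snd (X q)) p).

(* The metric induced from E3 (first fundamental form). *)
Definition induced_metric (X : R * R -> E3) : metric :=
  fun i j p => dot (tangent X i p) (tangent X j p).

(* The tangent vector V^s X_s + V^t X_t of E3. *)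
Definition push (X : R * R -> E3) (V : vfield) (p : R * R) : E3 :=
  vadd (vscale (V cs p) (tangent X cs p)) (vscale (V ct p) (tangent X ct p)).

(* x = x^T + x^N on D, with x^T = dX(V) tangent and x^N normal. *)
Definition canonical_field (D : R * R -> Prop) (X : R * R -> E3) (V : vfield)
    : Prop :=
  forall p, D p -> exists xN : E3,
    X p = vadd (push X V p) xN /\ forall i, dot xN (tangent X i p) = 0.

(* Where X is an immersion the canonical field exists and is unique on D,
   so that the existential in [incompressible_canonical_field] below is
   harmless. *)
Lemma canonical_field_exists (D : R * R -> Prop) (X : R * R -> E3) :
  (forall p, D p -> gdet (induced_metric X) p <> 0) ->
  exists V, canonical_field D X V.
Proof.
intros H.
exists (fun i p => sumc (fun j =>
  ginv (induced_metric X) i j p * dot (X p) (tangent X j p))).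
intros p Dp; specialize (H p Dp).
exists (vadd (X p) (vscale (-1) (push X (fun i p => sumc (fun j =>
  ginv (induced_metric X) i j p * dot (X p) (tangent X j p))) p))).
revert H; unfold push, sumc, ginv, gdet, induced_metric; cbv beta iota.
destruct (X p) as [[x1 x2] x3], (tangent X cs p) as [[a1 a2] a3] eqn:Ea,
  (tangent X ct p) as [[b1 b2] b3] eqn:Eb.
cbn -[tangent]; intros H; split.
- f_equal; [f_equal|]; ring.
- intros [|]; rewrite ?Ea, ?Eb; cbn; field; exact H.
Qed.

Lemma canonical_field_unique (D : R * R -> Prop) (X : R * R -> E3)
    (V W : vfield) :
  (forall p, D p -> gdet (induced_metric X) p <> 0) ->
  canonical_field D X V -> canonical_field D X W ->
  forall p, D p -> forall i, V i p = W i p.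
Proof.
assert (K : forall U, canonical_field D X U -> forall p, D p -> forall i,
  dot (X p) (tangent X i p) =
  U cs p * induced_metric X cs i p + U ct p * induced_metric X ct i p).
{ intros U HU p Dp i; destruct (HU p Dp) as [[[n1 n2] n3] [E N]].
  specialize (N i); rewrite E; revert N; unfold push, induced_metric.
  destruct (tangent X cs p) as [[a1 a2] a3], (tangent X ct p) as [[b1 b2] b3],
    (tangent X i p) as [[c1 c2] c3]; cbn; intros N.
  apply Rminus_diag_uniq; rewrite <- N; ring. }
intros H HV HW p Dp i; specialize (H p Dp).
pose proof (K V HV p Dp cs) as V1; pose proof (K V HV p Dp ct) as V2.
pose proof (K W HW p Dp cs) as W1; pose proof (K W HW p Dp ct) as W2.
rewrite V1 in W1; rewrite V2 in W2; clear V1 V2.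
unfold gdet in H; apply Rminus_diag_uniq.
apply (Rmult_eq_reg_r _ _ _ ) with (2 := H); rewrite Rmult_0_l.
set (A := induced_metric X cs cs p) in *; set (B := induced_metric X cs ct p) in *.
set (C := induced_metric X ct cs p) in *; set (E := induced_metric X ct ct p) in *.
destruct i.
- transitivity (E * ((V cs p * A + V ct p * C) - (W cs p * A + W ct p * C))
    - C * ((V cs p * B + V ct p * E) - (W cs p * B + W ct p * E))); [ring|].
  rewrite W1, W2; ring.
- transitivity (A * ((V cs p * B + V ct p * E) - (W cs p * B + W ct p * E))
    - B * ((V cs p * A + V ct p * C) - (W cs p * A + W ct p * C))); [ring|].
  rewrite W1, W2; ring.
Qed.

Definition incompressible_canonical_field (D : R * R -> Prop)
    (X : R * R -> E3) : Prop :=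
  exists V : vfield,
    canonical_field D X V /\ incompressible D (induced_metric X) V.

(* Open interval, possibly unbounded. *)
Definition in_interval (a b : Rbar) (s : R) : Prop :=
  Rbar_lt a s /\ Rbar_lt s b.

Definition smooth_on (a b : Rbar) (f : R -> R) : Prop :=
  forall (n : nat) (s : R), in_interval a b s -> ex_derive_n f n s.

Definition revolution (r : R -> R) (p : R * R) : E3 :=
  (r (fst p) * cos (snd p), r (fst p) * sin (snd p), fst p).

(* Main.v *)
(** The induced metric is [(1 + r'^2) ds^2 + r^2 dt^2] and the canonical field
    is [((s + r r') / (1 + r'^2)) d_s], since the position vector is orthogonal
    to [d_t].  Its divergence, multiplied by the positive factor
    [r (1 + r'^2)^2], is the left-hand side of the differential equation. *)
Require Import Defs.
From Stdlib Require Import Reals Lra.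
From Coquelicot Require Import Coquelicot.
Open Scope R_scope.

Lemma in_interval_locally (a b : Rbar) (s : R) :
  in_interval a b s -> locally s (in_interval a b).
Proof.
intros [Ha Hb].
apply filter_and; [apply (open_Rbar_gt' s a) | apply (open_Rbar_lt' s b)];
  assumption.
Qed.

(** The coefficient of the orthogonal projection of the position vector onto d_s: the numerator is
    the inner product of the two, the denominator the squared length of d_s. *)
Definition canonical_component (r : R -> R) (s : R) : R :=
  (s + r s * Derive r s) / (1 + Derive r s ^ 2).

Lemma one_plus_sqr_pos (x : R) : 0 < 1 + x ^ 2.
Proof. pose proof (pow2_ge_0 x); lra. Qed.

Lemma tangent_revolution_cs (r : R -> R) (p : R * R) :
  tangent (revolution r) cs p =
  (Derive r (fst p) * cos (snd p), Derive r (fst p) * sin (snd p), 1).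
Proof.
unfold tangent, revolution; simpl.
rewrite 2!Derive_scal_l, Derive_id; reflexivity.
Qed.

Lemma tangent_revolution_ct (r : R -> R) (p : R * R) :
  tangent (revolution r) ct p =
  (- (r (fst p) * sin (snd p)), r (fst p) * cos (snd p), 0).
Proof.
unfold tangent, revolution; simpl.
rewrite 2!Derive_scal, Derive_const.
rewrite (is_derive_unique cos _ _ (is_derive_cos _)).
rewrite (is_derive_unique sin _ _ (is_derive_sin _)).
f_equal; f_equal; ring.
Qed.

Lemma induced_metric_revolution (r : R -> R) (i j : coord) (p : R * R) :
  induced_metric (revolution r) i j p =
  match i, j with
  | cs, cs => 1 + Derive r (fst p) ^ 2
  | ct, ct => r (fst p) ^ 2
  | _, _ => 0
  end.
Proof.
pose proof (sin2_cos2 (snd p)) as H; unfold Rsqr in H.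
unfold induced_metric.
destruct i, j; rewrite ?tangent_revolution_cs, ?tangent_revolution_ct;
  simpl dot; try ring.
- transitivity (Derive r (fst p) ^ 2 *
    (sin (snd p) * sin (snd p) + cos (snd p) * cos (snd p)) + 1);
    [ring | rewrite H; ring].
- transitivity (r (fst p) ^ 2 *
    (sin (snd p) * sin (snd p) + cos (snd p) * cos (snd p)));
    [ring | rewrite H; ring].
Qed.

Lemma gdet_revolution (r : R -> R) (p : R * R) :
  gdet (induced_metric (revolution r)) p =
  (1 + Derive r (fst p) ^ 2) * r (fst p) ^ 2.
Proof. unfold gdet; rewrite !induced_metric_revolution; ring. Qed.

Lemma gdet_revolution_neq_0 (r : R -> R) (p : R * R) :
  0 < r (fst p) -> gdet (induced_metric (revolution r)) p <> 0.
Proof.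
intros Hr; rewrite gdet_revolution.
apply Rgt_not_eq, Rmult_lt_0_compat; [apply one_plus_sqr_pos|].
now apply pow_lt.
Qed.

Lemma canonical_field_revolution (D : R * R -> Prop) (r : R -> R) :
  canonical_field D (revolution r)
    (fun i p => match i with cs => canonical_component r (fst p) | ct => 0 end).
Proof.
intros p _.
set (c := canonical_component r (fst p)).
(* The normal part is forced to be what remains of the position vector after its d_s component is
   removed. *)
exists (vadd (revolution r p)
  (vscale (- c) (tangent (revolution r) cs p))).
pose proof (sin2_cos2 (snd p)) as H; unfold Rsqr in H.
unfold push; split.
- rewrite tangent_revolution_cs, tangent_revolution_ct; simpl.
  unfold revolution; fold c; f_equal; [f_equal|]; ring.
- intros [|]; rewrite tangent_revolution_cs, ?tangent_revolution_ct; simpl.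
  (* Once the sum of squares is replaced by 1, orthogonality to d_s becomes the linear equation in
     [c] that [canonical_component] solves. *)
  + transitivity ((r (fst p) - c * Derive r (fst p)) * Derive r (fst p) *
      (sin (snd p) * sin (snd p) + cos (snd p) * cos (snd p)) + fst p - c);
      [ring | rewrite H].
    unfold c, canonical_component; field.
    apply Rgt_not_eq, one_plus_sqr_pos.
  + ring.
Qed.

Lemma partial_induced_metric_revolution (r : R -> R) (k i j : coord)
    (p : R * R) :
  ex_derive r (fst p) -> ex_derive (Derive r) (fst p) ->
  partial k (induced_metric (revolution r) i j) p =
  match k, i, j with
  | cs, cs, cs => 2 * Derive r (fst p) * Derive_n r 2 (fst p)
  | cs, ct, ct => 2 * r (fst p) * Derive r (fst p)
  | _, _, _ => 0
  end.
Proof.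
intros H1 H2; destruct k; simpl partial;
  rewrite (Derive_ext _ _ _ (fun x => induced_metric_revolution r i j _));
  destruct i, j; simpl fst; rewrite ?Derive_const; try reflexivity;
  apply is_derive_unique; auto_derive; auto;
  (* [auto_derive] leaves eta-expanded functions; these conversions give [ring] a single form for
     each of r, r' and r''. *)
  change (Derive_n r 2) with (Derive (Derive r));
  change (Derive (fun x => r x)) with (Derive r);
  change (Derive (fun x => Derive r x)) with (Derive (Derive r)); ring.
Qed.

Lemma is_derive_canonical_component (r : R -> R) (s : R) :
  ex_derive r s -> ex_derive (Derive r) s ->
  is_derive (canonical_component r) s
    (((1 + Derive r s ^ 2 + r s * Derive_n r 2 s) * (1 + Derive r s ^ 2)
      - (s + r s * Derive r s) * (2 * Derive r s * Derive_n r 2 s))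
     / (1 + Derive r s ^ 2) ^ 2).
Proof.
intros H1 H2; unfold canonical_component.
pose proof (Rgt_not_eq _ _ (one_plus_sqr_pos (Derive r s))).
auto_derive; [auto|].
change (Derive_n r 2) with (Derive (Derive r)).
change (Derive (fun x => r x)) with (Derive r).
change (Derive (fun x => Derive r x)) with (Derive (Derive r)).
field; auto.
Qed.

(** With f the d_s component, the divergence is f' + (r' r'' / (1 + r'^2) + r' / r) f, the bracket
    being the sum of the Christoffel symbols Gamma^s_{ss} and Gamma^t_{ts}; the prefactor clears all
    denominators. Stating it for every canonical [V] serves both an unknown witness and the explicit
    field. *)
Lemma divergence_canonical_field_revolution (a b : Rbar) (r : R -> R)
    (V : vfield) (p : R * R) :
  smooth_on a b r ->
  (forall s : R, in_interval a b s -> 0 < r s) ->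
  canonical_field (fun p => in_interval a b (fst p)) (revolution r) V ->
  in_interval a b (fst p) ->
  r (fst p) * (1 + Derive r (fst p) ^ 2) ^ 2
    * divergence (induced_metric (revolution r)) V p =
  (1 + Derive r (fst p) ^ 2)
    * (r (fst p) + fst p * Derive r (fst p)
       + 2 * r (fst p) * Derive r (fst p) ^ 2)
  + r (fst p) * (r (fst p) - fst p * Derive r (fst p)) * Derive_n r 2 (fst p).
Proof.
intros Hs Hpos HV Dp.
assert (HVW : forall q, in_interval a b (fst q) -> forall i,
  V i q = match i with cs => canonical_component r (fst q) | ct => 0 end).
{ apply (canonical_field_unique _ (revolution r)); auto.
  - intros q Dq; apply gdet_revolution_neq_0; auto.
  - apply canonical_field_revolution. }
assert (H1 : ex_derive r (fst p)) by exact (Hs 1%nat _ Dp).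
assert (H2 : ex_derive (Derive r) (fst p)) by exact (Hs 2%nat _ Dp).
(* [V] is known only over the interval, so its s-derivative is computed locally, by openness of the
   interval. *)
assert (Hs' : partial cs (V cs) p = Derive (canonical_component r) (fst p)).
{ apply Derive_ext_loc.
  apply (filter_imp (in_interval a b)); [|now apply in_interval_locally].
  intros x Dx; exact (HVW (x, snd p) Dx cs). }
(* The whole t-line through [p] lies in the domain, so here no localisation is required. *)
assert (Ht' : partial ct (V ct) p = 0).
{ simpl; rewrite (Derive_ext _ (fun _ => 0)); [apply Derive_const|].
  intros t; exact (HVW (fst p, t) Dp ct). }
pose proof (Rgt_not_eq _ _ (one_plus_sqr_pos (Derive r (fst p)))).
pose proof (Rgt_not_eq _ _ (Hpos _ Dp)).
unfold divergence, nabla, christoffel, sumc.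
rewrite Hs', Ht', !HVW by assumption.
rewrite (is_derive_unique _ _ _ (is_derive_canonical_component r _ H1 H2)).
rewrite !(partial_induced_metric_revolution r) by assumption.
unfold ginv; rewrite !gdet_revolution, !induced_metric_revolution.
unfold canonical_component; field; auto.
Qed.

Theorem proposition5p1 (a b : Rbar) (r : R -> R)
    (hsmooth : smooth_on a b r)
    (hpos : forall s : R, in_interval a b s -> 0 < r s) :
  incompressible_canonical_field
    (fun p : R * R => in_interval a b (fst p)) (revolution r)
  <->
  (forall s : R, in_interval a b s ->
     (1 + Derive r s ^ 2) * (r s + s * Derive r s + 2 * r s * Derive r s ^ 2)
       + r s * (r s - s * Derive r s) * Derive_n r 2 s = 0).
Proof.
split.
- intros [V [HV Hdiv]] s Ds.
  (* The choice t = 0 is arbitrary: by rotational symmetry the equation involves s alone. *)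
  etransitivity;
    [symmetry; now apply (divergence_canonical_field_revolution a b r V (s, 0))|].
  rewrite Hdiv by assumption; ring.
- intros Hode.
  exists (fun i p => match i with cs => canonical_component r (fst p) | ct => 0 end).
  split; [apply canonical_field_revolution|]; intros p Dp.
  (* The prefactor is positive, since r is, and can be cancelled. *)
  apply (Rmult_eq_reg_l (r (fst p) * (1 + Derive r (fst p) ^ 2) ^ 2)).
  + rewrite (divergence_canonical_field_revolution a b) by
      (assumption || apply canonical_field_revolution).
    rewrite Rmult_0_r; auto.
  + apply Rgt_not_eq, Rmult_lt_0_compat; [auto|].
    apply pow_lt, one_plus_sqr_pos.
Qed.
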